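(* Let $\mathfrak g$ and $\mathfrak h$ be Lie algebras. Consider a vector bundle morphism $\Phi\colon TI\times\mathfrak g\to\mathfrak h$ over $\phi\colon I\times\{*\}\to\{*\}$. Then $(\Phi,\phi)$ is an LA-morphism, i.e. an LA-homotopy between $\Phi_0:=\Phi(0|_0,\cdot)$ and $\Phi_1:=\Phi(0|_1,\cdot)\colon\mathfrak g\to\mathfrak h$, if and only if it can be written, by means of smooth curves $c\colon I\to\mathfrak h$ and $\psi\colon I\to\operatorname{Hom}(\mathfrak g,\mathfrak h)$ with $\psi_0$ a morphism of Lie algebras, as $$\Phi(r\,\partial_t|_s,x)=r\,c(s)+\psi_s(x)$$ for $r\in\mathbb R$, $s\in I$ and $x\in\mathfrak g$, satisfying the differential equation $$(\partial_t\psi)_s(x)=-\operatorname{ad}_{c(s)}(\psi_s(x)):=-[c(s),\psi_s(x)]$$ for each $s\in I$ and each $x\in\mathfrak g$.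
   Context: Lie algebras are finite-dimensional and real; $I$ is an open interval containing $0$ and $1$ with coordinate $t$. $\operatorname{Hom}(\mathfrak g,\mathfrak h)$ is the space of linear maps and $0|_j\in T_jI$ is the zero vector. A Lie algebroid is a vector bundle $A\to M$ with an $\mathbb R$-Lie bracket on $\Gamma(A)$ and an anchor $\rho_A\colon A\to TM$ (vector bundle morphism over $\mathrm{id}_M$) such that $[a_1,fa_2]=f[a_1,a_2]+\rho_A(a_1)(f)a_2$; a Lie algebra is a Lie algebroid over a point. A vector bundle morphism $\Phi\colon A\to B$ over $\phi$ is an LA-morphism if it is compatible with anchors and brackets; equivalently, if $\Phi^*\colon\Gamma(\wedge^\bullet B^* )\to\Gamma(\wedge^\bullet A^* )$ intertwines the Lie algebroid (Koszul) differentials. $TI\times\mathfrak g\to I\times\{*\}$ is the direct product Lie algebroid: its anchor is $(v,x)\mapsto v$, and for sections $(f\partial_t,x),(g\partial_t,y)$ with $f,g\in C^\infty(I)$, $x,y\in C^\infty(I,\mathfrak g)$, the bracket is $((fg'-gf')\partial_t,[x,y]+fy'-gx')$. An LA-homotopy between two Lie algebra morphisms $\Phi_0,\Phi_1\colon\mathfrak g\to\mathfrak h$ is an LA-morphism $\Phi\colon TI\times\mathfrak g\to\mathfrak h$ with $\Phi(0|_j,\cdot)=\Phi_j$ for $j=0,1$. *)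

(* Defs.v *)
From HB Require Import structures.
From mathcomp Require Import all_boot all_order all_algebra.
From mathcomp Require Import all_classical all_reals all_analysis.
From mathcomp Require Import ring lra.
Set Implicit Arguments.
Unset Strict Implicit.
Unset Printing Implicit Defensive.
Import Order.TTheory GRing.Theory Num.Theory.
Import numFieldNormedType.Exports.
Local Open Scope classical_set_scope.
Local Open Scope ring_scope.

HB.mixin Record isLieAlgebra (R : fieldType) (V : Type) of Vector R V := {
  lie : V -> V -> V ;
  lie_linearl : forall y : V, linear (lie^~ y) ;
  lie_linearr : forall x : V, linear (lie x) ;
  liexx : forall x : V, lie x x = 0 ;
  lie_jacobi : forall x y z : V,
    lie x (lie y z) + lie y (lie z x) + lie z (lie x y) = 0
}.

#[short(type="lieAlgType")]
HB.structure Definition LieAlgebra (R : fieldType) :=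
  { V of isLieAlgebra R V & Vector R V }.

Section LieTheory.
Context {R : fieldType} {V : lieAlgType R}.
Implicit Types x y z : V.

Lemma lieDl x y z : lie (x + y) z = lie x z + lie y z.
Proof. by have := lie_linearl z 1 x y; rewrite !scale1r. Qed.

Lemma lieDr x y z : lie x (y + z) = lie x y + lie x z.
Proof. by have := lie_linearr x 1 y z; rewrite !scale1r. Qed.

Lemma lie0l y : lie 0 y = 0.
Proof. by apply: (addIr (lie 0 y)); rewrite -lieDl !add0r. Qed.

Lemma lie0r x : lie x 0 = 0.
Proof. by apply: (addIr (lie x 0)); rewrite -lieDr !add0r. Qed.

Lemma lieZl k x y : lie (k *: x) y = k *: lie x y.
Proof. by have := lie_linearl y k x 0; rewrite !addr0 lie0l addr0. Qed.

Lemma lieZr k x y : lie x (k *: y) = k *: lie x y.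
Proof. by have := lie_linearr x k y 0; rewrite !addr0 lie0r addr0. Qed.

Lemma lieNl x y : lie (- x) y = - lie x y.
Proof. by rewrite -scaleN1r lieZl scaleN1r. Qed.

Lemma lieNr x y : lie x (- y) = - lie x y.
Proof. by rewrite -scaleN1r lieZr scaleN1r. Qed.

Lemma lieC x y : lie x y = - lie y x.
Proof.
apply/eqP; rewrite -addr_eq0; have := liexx (x + y).
by rewrite lieDl !lieDr !liexx add0r addr0 => ->.
Qed.

End LieTheory.

Definition lie_morphism (R : fieldType) (g h : lieAlgType R) (f : g -> h) :=
  linear f /\ forall x y : g, f (lie x y) = lie (f x) (f y).

(* A base manifold enters only through its points and its algebra of smooth
   functions. *)
Record smooth_space (R : realType) := SmoothSpace {
  point_of :> Type ;
  Cinf : set (point_of -> R) ;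
  Cinf_cst : forall c : R, Cinf (fun=> c) ;
  Cinf_add : forall u v, Cinf u -> Cinf v -> Cinf (fun p => u p + v p) ;
  Cinf_mul : forall u v, Cinf u -> Cinf v -> Cinf (fun p => u p * v p)
}.

Section Smooth.
Context {R : realType}.

Definition smooth_map (M N : smooth_space R) (phi : M -> N) :=
  forall u : N -> R, Cinf u -> Cinf (u \o phi).

(* Smoothness of a map into a finite-dimensional vector space, i.e. of a
   section of a trivial bundle, in the linear chart given by a basis. *)
Definition smooth_vec (M : smooth_space R) (V : vectType R) (a : M -> V) :=
  forall i, Cinf (fun p => coord (vbasis {:V}) i (a p)).

(* Tangent vectors at p are the point derivations of C^oo(M) at p; the values
   of X outside C^oo(M) are irrelevant. *)
Definition tangent_vector (M : smooth_space R) (p : M) (X : (M -> R) -> R) :=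
  [/\ forall u v : M -> R, Cinf u -> Cinf v ->
        X (fun q => u q + v q) = X u + X v,
      forall (k : R) (u : M -> R), Cinf u -> X (fun q => k * u q) = k * X u
    & forall u v : M -> R, Cinf u -> Cinf v ->
        X (fun q => u q * v q) = X u * v p + u p * X v].

(* Lie algebroids on the trivial bundle M x fiber.  Sections are the smooth
   functions M -> fiber; the values of the bracket on other functions are
   irrelevant. *)
Record lie_algebroid (M : smooth_space R) := LieAlgebroid {
  fiber : vectType R ;
  anchor : M -> fiber -> (M -> R) -> R ;
  bracket : (M -> fiber) -> (M -> fiber) -> (M -> fiber) ;
  anchor_linear : forall (p : M) (k : R) (v w : fiber) (u : M -> R), Cinf u ->
    anchor p (k *: v + w) u = k * anchor p v u + anchor p w u ;
  anchor_tangent : forall (p : M) (v : fiber), tangent_vector p (anchor p v) ;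
  anchor_smooth : forall (a : M -> fiber) (u : M -> R),
    smooth_vec a -> Cinf u -> Cinf (fun p => anchor p (a p) u) ;
  bracket_smooth : forall a b : M -> fiber,
    smooth_vec a -> smooth_vec b -> smooth_vec (bracket a b) ;
  bracket_linearl : forall (k : R) (a b c : M -> fiber),
    smooth_vec a -> smooth_vec b -> smooth_vec c ->
    forall p, bracket (fun q => k *: a q + b q) c p
              = k *: bracket a c p + bracket b c p ;
  bracket_alt : forall a : M -> fiber, smooth_vec a ->
    forall p, bracket a a p = 0 ;
  bracket_jacobi : forall a b c : M -> fiber,
    smooth_vec a -> smooth_vec b -> smooth_vec c ->
    forall p, bracket a (bracket b c) p + bracket b (bracket c a) p
              + bracket c (bracket a b) p = 0 ;
  bracket_leibniz : forall (a b : M -> fiber) (u : M -> R),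
    smooth_vec a -> smooth_vec b -> Cinf u ->
    forall p, bracket a (fun q => u q *: b q) p
              = u p *: bracket a b p + anchor p (a p) u *: b p
}.

(* For trivial bundles and fibrewise linear Phi, smoothness of the total map
   (p, v) |-> Phi p v amounts to smoothness of p |-> Phi p v for each v. *)
Definition bundle_morphism (M N : smooth_space R)
    (A : lie_algebroid M) (B : lie_algebroid N)
    (Phi : M -> fiber A -> fiber B) (phi : M -> N) :=
  [/\ smooth_map phi,
      forall p, linear (Phi p)
    & forall v, smooth_vec (fun p => Phi p v)].

(* T phi o rho_A = rho_B o Phi, as T phi maps a derivation X to u |-> X (u o phi). *)
Definition anchor_compatible (M N : smooth_space R)
    (A : lie_algebroid M) (B : lie_algebroid N)
    (Phi : M -> fiber A -> fiber B) (phi : M -> N) :=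
  forall (p : M) (v : fiber A) (u : N -> R), Cinf u ->
    anchor (phi p) (Phi p v) u = anchor p v (u \o phi).

(* Phi o a = \sum_i u_i (b_i o phi) as sections of the pullback of B along phi. *)
Definition decomposition (M N : smooth_space R)
    (A : lie_algebroid M) (B : lie_algebroid N)
    (Phi : M -> fiber A -> fiber B) (phi : M -> N) (a : M -> fiber A)
    (n : nat) (u : 'I_n -> M -> R) (b : 'I_n -> N -> fiber B) :=
  [/\ forall i, Cinf (u i), forall i, smooth_vec (b i)
    & forall p, Phi p (a p) = \sum_(i < n) u i p *: b i (phi p)].

(* A section of A need not be mapped to a section of B when phi is not a
   diffeomorphism, so compatibility with the brackets is expressed, following
   Higgins and Mackenzie, by decompositions in the pullback bundle:
     Phi o [a1, a2] = \sum_(i, j) u1_i u2_j ([b1_i, b2_j] o phi)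
                    + \sum_j rho_A(a1)(u2_j) (b2_j o phi)
                    - \sum_i rho_A(a2)(u1_i) (b1_i o phi). *)
Definition bracket_compatible (M N : smooth_space R)
    (A : lie_algebroid M) (B : lie_algebroid N)
    (Phi : M -> fiber A -> fiber B) (phi : M -> N) :=
  forall a1 a2 : M -> fiber A, smooth_vec a1 -> smooth_vec a2 ->
  forall n1 (u1 : 'I_n1 -> M -> R) (b1 : 'I_n1 -> N -> fiber B)
         n2 (u2 : 'I_n2 -> M -> R) (b2 : 'I_n2 -> N -> fiber B),
    decomposition Phi phi a1 u1 b1 -> decomposition Phi phi a2 u2 b2 ->
  forall p, Phi p (bracket a1 a2 p) =
      \sum_(i < n1) \sum_(j < n2)
        (u1 i p * u2 j p) *: bracket (b1 i) (b2 j) (phi p)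
    + \sum_(j < n2) anchor p (a1 p) (u2 j) *: b2 j (phi p)
    - \sum_(i < n1) anchor p (a2 p) (u1 i) *: b1 i (phi p).

Definition LA_morphism (M N : smooth_space R)
    (A : lie_algebroid M) (B : lie_algebroid N)
    (Phi : M -> fiber A -> fiber B) (phi : M -> N) :=
  [/\ bundle_morphism Phi phi, anchor_compatible Phi phi
    & bracket_compatible Phi phi].

End Smooth.

Section PointBase.
Context {R : realType}.

Definition point_space : smooth_space R :=
  @SmoothSpace R unit setT (fun=> Logic.I) (fun _ _ _ _ => Logic.I)
    (fun _ _ _ _ => Logic.I).

Definition algebroid_of_lie (h : lieAlgType R) : lie_algebroid point_space.
Proof.
refine (@LieAlgebroid R point_space h (fun _ _ _ => 0)
  (fun a b p => lie (a p) (b p)) _ _ _ _ _ _ _ _).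
- by move=> *; rewrite mulr0 addr0.
- by move=> p v; split=> *; rewrite ?(addr0, mulr0, mul0r).
- by [].
- by [].
- by move=> k a b c _ _ _ p; rewrite lieDl lieZl.
- by move=> a _ p; apply: liexx.
- by move=> a b c _ _ _ p; apply: lie_jacobi.
- by move=> a b u _ _ _ p; rewrite scale0r addr0 lieZr.
Defined.

End PointBase.

Section OpenIntervals.
Context {R : realType}.

Record open_interval := OpenInterval {
  itv_set :> set R ;
  itv_open : open itv_set ;
  itv_interval : is_interval itv_set
}.

Context {I : open_interval}.
Implicit Types (f g : I -> R) (s : I).

(* Functions on I are differentiated after extension by 0 to the whole line,
   which does not affect the derivative at a point of the open set I. *)
Definition differentiable_on f := forall s, derivable ('valL_0 f) (val s) 1.

Definition ddt f : I -> R := fun s => derive1 ('valL_0 f) (val s).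

Definition smooth_on : set (I -> R) :=
  fun f => forall n, differentiable_on (iter n ddt f).

Lemma ext0E f s : 'valL_0 f (val s) = f s.
Proof. by rewrite /= oinv_set_val valK. Qed.

Lemma ext0D f g :
  'valL_0 (fun s => f s + g s) = ('valL_0 f : R -> R) + 'valL_0 g.
Proof.
apply/funext => t; rewrite fctE /= oinv_set_val; case: insub => //=.
by rewrite addr0.
Qed.

Lemma ext0M f g :
  'valL_0 (fun s => f s * g s) = ('valL_0 f : R -> R) * 'valL_0 g.
Proof.
apply/funext => t; rewrite fctE /= oinv_set_val; case: insub => //=.
by rewrite mulr0.
Qed.

Lemma near_itv s : \forall t \near val s, itv_set I t.
Proof. by apply: open_nbhs_nbhs; split; [exact: itv_open|exact: set_mem (valP s)]. Qed.

Lemma is_derive_ext0_cst (k : R) s :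
  is_derive (val s) 1 ('valL_0 (fun _ : I => k)) 0.
Proof.
apply: (near_eq_is_derive (f := cst k)).
near=> t; have It : itv_set I t by near: t; apply: near_itv.
by rewrite /= oinv_set_val insubT ?inE.
Unshelve. all: by end_near. Qed.

Lemma differentiable_cst (k : R) : differentiable_on (fun=> k).
Proof. by move=> s; have [] := is_derive_ext0_cst k s. Qed.

Lemma ddt_cst (k : R) : ddt (fun=> k) = fun=> 0.
Proof.
by apply/funext => s; rewrite /ddt derive1E; have [_ ->] := is_derive_ext0_cst k s.
Qed.

Lemma differentiableD f g : differentiable_on f -> differentiable_on g ->
  differentiable_on (fun s => f s + g s).
Proof. by move=> df dg s; rewrite ext0D; apply: derivableD. Qed.

Lemma ddtD f g : differentiable_on f -> differentiable_on g ->
  ddt (fun s => f s + g s) = fun s => ddt f s + ddt g s.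
Proof.
move=> df dg; apply/funext => s; rewrite /ddt ext0D !derive1E.
exact: deriveD (df s) (dg s).
Qed.

Lemma differentiableM f g : differentiable_on f -> differentiable_on g ->
  differentiable_on (fun s => f s * g s).
Proof. by move=> df dg s; rewrite ext0M; apply: derivableM. Qed.

Lemma ddtM f g : differentiable_on f -> differentiable_on g ->
  ddt (fun s => f s * g s) = fun s => ddt f s * g s + f s * ddt g s.
Proof.
move=> df dg; apply/funext => s; rewrite /ddt ext0M !derive1E deriveM//.
by rewrite !ext0E /GRing.scale/= addrC mulrC.
Qed.

Lemma smooth_differentiable f : smooth_on f -> differentiable_on f.
Proof. by move=> /(_ 0%N). Qed.

Lemma smooth_ddt f : smooth_on f -> smooth_on (ddt f).
Proof. by move=> sf n; have := sf n.+1; rewrite iterSr. Qed.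

Lemma smooth_cst (k : R) : smooth_on (fun=> k).
Proof.
move=> n; elim: n k => [|n IHn] k; first exact: differentiable_cst.
by rewrite iterSr ddt_cst.
Qed.

Lemma iter_ddtD n f g :
  (forall m, (m < n)%N -> differentiable_on (iter m ddt f)) ->
  (forall m, (m < n)%N -> differentiable_on (iter m ddt g)) ->
  iter n ddt (fun s => f s + g s) = fun s => iter n ddt f s + iter n ddt g s.
Proof.
elim: n => //= n IHn df dg; rewrite IHn; first by rewrite ddtD; auto.
- by move=> m mn; apply/df/ltnW.
- by move=> m mn; apply/dg/ltnW.
Qed.

Lemma smoothD f g : smooth_on f -> smooth_on g ->
  smooth_on (fun s => f s + g s).
Proof. by move=> sf sg n; rewrite iter_ddtD//; apply: differentiableD. Qed.

Lemma smoothM f g : smooth_on f -> smooth_on g ->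
  smooth_on (fun s => f s * g s).
Proof.
move=> sf sg n.
suff : forall m, (m <= n)%N ->
  differentiable_on (iter m ddt (fun s => f s * g s)) by apply.
have dM u v : smooth_on u -> smooth_on v ->
    differentiable_on (fun s => u s * v s).
  by move=> su sv; apply: differentiableM; apply: smooth_differentiable.
elim: n f g sf sg => [|n IHn] f g sf sg [|m] mn; [exact: dM|by []|exact: dM|].
have sf' := smooth_ddt sf; have sg' := smooth_ddt sg.
rewrite iterSr ddtM; [|exact: smooth_differentiable..].
rewrite iter_ddtD => [|k km|k km].
- by apply: differentiableD; apply: IHn.
- by apply: IHn => //; apply: leq_trans (ltnW km) _.
- by apply: IHn => //; apply: leq_trans (ltnW km) _.
Qed.

Definition interval_space : smooth_space R :=
  SmoothSpace smooth_cst smoothD smoothM.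

End OpenIntervals.

Arguments open_interval : clear implicits.
Arguments interval_space {R} I.

Lemma linear_comb (R : fieldType) (V W : vectType R) (l : V -> W) n
    (k : 'I_n -> R) (v : 'I_n -> V) : linear l ->
  l (\sum_(i < n) k i *: v i) = \sum_(i < n) k i *: l (v i).
Proof.
move=> ll; have l0 : l 0 = 0.
  by apply: (addIr (l 0)); have := ll 1 0 0; rewrite !scale1r add0r => <-; rewrite add0r.
by elim/big_rec2: _ => // i _ y _ <-; rewrite ll.
Qed.

Lemma coord_comb (R : fieldType) (V : vectType R) (v : V) :
  v = \sum_i coord (vbasis {:V}) i v *: (vbasis {:V})`_i.
Proof. by rewrite -coord_vbasis// memvf. Qed.

Lemma coord_inj (R : fieldType) (V : vectType R) (v w : V) :
  (forall i, coord (vbasis {:V}) i v = coord (vbasis {:V}) i w) -> v = w.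
Proof.
by move=> vw; rewrite (coord_comb v) (coord_comb w); apply: eq_bigr => i _; rewrite vw.
Qed.

Lemma coord_basis_comb (R : fieldType) (V : vectType R) (k : 'I_(\dim {:V}) -> R) i :
  coord (vbasis {:V}) i (\sum_j k j *: (vbasis {:V})`_j) = k i.
Proof. by rewrite coord_sum_free// (basis_free (vbasisP _)). Qed.

Section SmoothVec.
Context {R : realType} {M : smooth_space R}.

Lemma Cinf_eq (u v : M -> R) : u =1 v -> Cinf u -> Cinf v.
Proof. by move=> /funext ->. Qed.

Lemma Cinf_sub (u v : M -> R) : Cinf u -> Cinf v -> Cinf (fun p => u p - v p).
Proof.
move=> su sv; apply: (@Cinf_eq (fun p => u p + -1 * v p)) => [p|].
  by rewrite mulN1r.
by apply: Cinf_add => //; apply: Cinf_mul => //; apply: Cinf_cst.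
Qed.

Lemma Cinf_sum n (u : 'I_n -> M -> R) :
  (forall i, Cinf (u i)) -> Cinf (fun p => \sum_(i < n) u i p).
Proof.
elim: n u => [|n IHn] u su.
  by apply: (@Cinf_eq (fun=> 0)) => [p|]; [rewrite big_ord0|apply: Cinf_cst].
apply: (@Cinf_eq (fun p => u ord0 p + \sum_(i < n) u (lift ord0 i) p)) => [p|].
  by rewrite big_ord_recl.
by apply: Cinf_add => //; apply: IHn.
Qed.

Lemma smooth_vecD (V : vectType R) (a b : M -> V) :
  smooth_vec a -> smooth_vec b -> smooth_vec (fun p => a p + b p).
Proof.
move=> sa sb i; have := Cinf_add (sa i) (sb i).
by apply: Cinf_eq => p; rewrite linearD.
Qed.

Lemma smooth_vecZ (V : vectType R) (u : M -> R) (a : M -> V) :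
  Cinf u -> smooth_vec a -> smooth_vec (fun p => u p *: a p).
Proof.
move=> su sa i; have := Cinf_mul su (sa i).
by apply: Cinf_eq => p; rewrite linearZ.
Qed.

Lemma smooth_vecB (V : vectType R) (a b : M -> V) :
  smooth_vec a -> smooth_vec b -> smooth_vec (fun p => a p - b p).
Proof.
move=> sa sb i; have := Cinf_sub (sa i) (sb i).
by apply: Cinf_eq => p; rewrite linearB.
Qed.

Lemma smooth_vec_cst (V : vectType R) (x : V) : smooth_vec (fun _ : M => x).
Proof. by move=> i; apply: Cinf_cst. Qed.

Lemma smooth_vec_comb (V : vectType R) n (u : 'I_n -> M -> R) (x : 'I_n -> V) :
  (forall i, Cinf (u i)) -> smooth_vec (fun p => \sum_(i < n) u i p *: x i).
Proof.
move=> su j; have := Cinf_sum (fun i => Cinf_mul (su i) (Cinf_cst M (coord (vbasis {:V}) j (x i)))).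
apply: Cinf_eq => p; rewrite linear_sum; apply: eq_bigr => i _.
by rewrite linearZ.
Qed.

Lemma smooth_vec_linear (V W : vectType R) (l : V -> W) (a : M -> V) :
  linear l -> smooth_vec a -> smooth_vec (fun p => l (a p)).
Proof.
move=> ll sa; have := smooth_vec_comb (fun i => l (vbasis {:V})`_i) sa.
by congr smooth_vec; apply/funext => p; rewrite [in RHS](coord_comb (a p)) linear_comb.
Qed.

Lemma bilinear_comb (V W X : vectType R) (f : V -> W -> X) (v : V) (w : W) :
  (forall w, linear (f^~ w)) -> (forall v, linear (f v)) ->
  f v w = \sum_i \sum_j (coord (vbasis {:V}) i v * coord (vbasis {:W}) j w)
                        *: f (vbasis {:V})`_i (vbasis {:W})`_j.
Proof.
move=> fl fr; rewrite {1}(coord_comb v) (@linear_comb _ _ _ (f^~ w))//.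
apply: eq_bigr => i _; rewrite {1}(coord_comb w) linear_comb// scaler_sumr.
by apply: eq_bigr => j _; rewrite scalerA.
Qed.

Lemma smooth_vec_sum (V : vectType R) n (a : 'I_n -> M -> V) :
  (forall i, smooth_vec (a i)) -> smooth_vec (fun p => \sum_(i < n) a i p).
Proof.
by move=> sa j; apply: Cinf_eq (Cinf_sum (fun i => sa i j)) => p; rewrite linear_sum.
Qed.

Lemma smooth_vec_bilinear (V W X : vectType R) (f : V -> W -> X) a b :
  (forall w, linear (f^~ w)) -> (forall v, linear (f v)) ->
  smooth_vec a -> smooth_vec b -> smooth_vec (fun p : M => f (a p) (b p)).
Proof.
move=> fl fr sa sb.
under eq_fun do rewrite bilinear_comb//.
apply: smooth_vec_sum => i; apply: smooth_vec_comb => j.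
exact: Cinf_mul.
Qed.

Lemma smooth_vec_scalar (u : M -> R^o) : smooth_vec u <-> Cinf u.
Proof.
split=> su; last first.
  by move=> i; apply: Cinf_eq (Cinf_mul su (Cinf_cst M (coord (vbasis {:R^o}) i 1))) => p;
    rewrite -[in RHS](mulr1 (u p)) -[u p * 1]/(u p *: (1 : R^o)) linearZ.
have := Cinf_sum (fun i => Cinf_mul (su i) (Cinf_cst M ((vbasis {:R^o})`_i : R))).
by apply: Cinf_eq => p; rewrite [RHS](coord_comb (u p)).
Qed.

Lemma smooth_vec_fst (V W : vectType R) (a : M -> V * W) :
  smooth_vec a -> smooth_vec (fun p => (a p).1).
Proof. by apply: smooth_vec_linear. Qed.

Lemma smooth_vec_snd (V W : vectType R) (a : M -> V * W) :
  smooth_vec a -> smooth_vec (fun p => (a p).2).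
Proof. by apply: smooth_vec_linear. Qed.

Lemma smooth_vec_pair (V W : vectType R) (a : M -> V) (b : M -> W) :
  smooth_vec a -> smooth_vec b -> smooth_vec (fun p => (a p, b p)).
Proof.
move=> sa sb.
have la : linear (fun v : V => (v, 0 : W)).
  by move=> k v w; congr (_, _); rewrite /= scaler0 addr0.
have lb : linear (fun w : W => (0 : V, w)).
  by move=> k v w; congr (_, _); rewrite /= scaler0 addr0.
have := smooth_vecD (smooth_vec_linear la sa) (smooth_vec_linear lb sb).
by congr smooth_vec; apply/funext => p; congr (_, _); rewrite /= ?addr0 ?add0r.
Qed.

End SmoothVec.

Section VectorCurves.
Context {R : realType} {I : open_interval R}.
Local Notation M := (interval_space I).

(* The derivative of a curve in V; coordinatewise, in a basis of V. *)
Definition ddtv (V : vectType R) (a : I -> V) : I -> V :=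
  fun s => \sum_i ddt (fun t => coord (vbasis {:V}) i (a t)) s *: (vbasis {:V})`_i.

Lemma ddtB (f g : I -> R) : smooth_on f -> smooth_on g ->
  ddt (fun s => f s - g s) = fun s => ddt f s - ddt g s.
Proof.
move=> sf sg; have dN : differentiable_on (fun s => -1 * g s).
  by apply: differentiableM; [exact: differentiable_cst|exact: smooth_differentiable].
have -> : (fun s => f s - g s) = (fun s => f s + -1 * g s).
  by apply/funext => s; rewrite mulN1r.
rewrite (ddtD (smooth_differentiable sf) dN).
rewrite ddtM; [|exact: differentiable_cst|exact: smooth_differentiable].
by apply/funext => s; rewrite ddt_cst mul0r add0r mulN1r.
Qed.

Lemma coord_ddtv (V : vectType R) (a : I -> V) i s :
  coord (vbasis {:V}) i (ddtv a s) = ddt (fun t => coord (vbasis {:V}) i (a t)) s.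
Proof. exact: coord_basis_comb. Qed.

Lemma smooth_ddtv (V : vectType R) (a : M -> V) :
  smooth_vec a -> smooth_vec (ddtv a : M -> V).
Proof.
by move=> sa i; have := smooth_ddt (sa i); apply: (@Cinf_eq _ M) => s; rewrite coord_ddtv.
Qed.

Lemma ddtvD (V : vectType R) (a b : M -> V) : smooth_vec a -> smooth_vec b ->
  ddtv (fun s => a s + b s) = fun s => ddtv a s + ddtv b s.
Proof.
move=> sa sb; apply/funext => s; apply: coord_inj => i.
rewrite linearD /= !coord_ddtv.
under [X in ddt X]eq_fun do rewrite linearD.
rewrite ddtD; [by []|exact: smooth_differentiable (sa i)|].
exact: smooth_differentiable (sb i).
Qed.

Lemma ddtvB (V : vectType R) (a b : M -> V) : smooth_vec a -> smooth_vec b ->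
  ddtv (fun s => a s - b s) = fun s => ddtv a s - ddtv b s.
Proof.
move=> sa sb; apply/funext => s; apply: coord_inj => i.
rewrite linearB /= !coord_ddtv.
under [X in ddt X]eq_fun do rewrite linearB.
by rewrite ddtB; [|exact: (sa i)|exact: (sb i)].
Qed.

Lemma ddtvZ (V : vectType R) (u : M -> R) (a : M -> V) :
  Cinf u -> smooth_vec a ->
  ddtv (fun s => u s *: a s) = fun s => ddt u s *: a s + u s *: ddtv a s.
Proof.
move=> su sa; apply/funext => s; apply: coord_inj => i.
rewrite linearD !linearZ /= !coord_ddtv.
under [X in ddt X]eq_fun do rewrite linearZ.
rewrite ddtM; [by []|exact: smooth_differentiable su|].
exact: smooth_differentiable (sa i).
Qed.

Lemma ddtv_cst (V : vectType R) (x : V) : ddtv (fun _ : I => x) = fun=> 0.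
Proof.
by apply/funext => s; apply: coord_inj => i; rewrite coord_ddtv ddt_cst linear0.
Qed.

Lemma ddtv_sum (V : vectType R) n (a : 'I_n -> M -> V) :
  (forall i, smooth_vec (a i)) ->
  ddtv (fun s => \sum_(i < n) a i s) = fun s => \sum_(i < n) ddtv (a i) s.
Proof.
elim: n a => [|n IHn] a sa.
  under eq_fun do rewrite big_ord0.
  by rewrite ddtv_cst; apply/funext => s; rewrite big_ord0.
under eq_fun do rewrite big_ord_recl.
rewrite ddtvD//; last exact: smooth_vec_sum.
by rewrite IHn//; apply/funext => s; rewrite big_ord_recl.
Qed.

Lemma ddtv_comb (V : vectType R) n (u : 'I_n -> M -> R) (x : 'I_n -> V) :
  (forall i, Cinf (u i)) ->
  ddtv (fun s => \sum_(i < n) u i s *: x i) = fun s => \sum_(i < n) ddt (u i) s *: x i.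
Proof.
move=> su; rewrite ddtv_sum => [|i]; last by apply/smooth_vecZ/smooth_vec_cst.
apply/funext => s; apply: eq_bigr => i _.
by rewrite ddtvZ ?ddtv_cst ?scaler0 ?addr0//; apply: smooth_vec_cst.
Qed.

Lemma ddtv_linear (V W : vectType R) (l : V -> W) (a : M -> V) :
  linear l -> smooth_vec a -> ddtv (fun s => l (a s)) = fun s => l (ddtv a s).
Proof.
move=> ll sa.
under eq_fun do rewrite (coord_comb (a _)) linear_comb//.
by rewrite ddtv_comb//; apply/funext => s; rewrite linear_comb.
Qed.

Lemma ddtv_bilinear (V W X : vectType R) (f : V -> W -> X) (a : M -> V) (b : M -> W) :
  (forall w, linear (f^~ w)) -> (forall v, linear (f v)) ->
  smooth_vec a -> smooth_vec b ->
  ddtv (fun s => f (a s) (b s)) = fun s => f (ddtv a s) (b s) + f (a s) (ddtv b s).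
Proof.
move=> fl fr sa sb.
under eq_fun do rewrite bilinear_comb//.
rewrite ddtv_sum => [|i]; last by apply: smooth_vec_comb => j; apply: Cinf_mul.
apply/funext => s; rewrite !(bilinear_comb _ _ fl fr) -big_split /=.
apply: eq_bigr => i _; rewrite ddtv_comb => [|j]; last exact: Cinf_mul.
rewrite -big_split /=; apply: eq_bigr => j _.
rewrite -scalerDl !coord_ddtv ddtM; [by []| |]; apply: smooth_differentiable;
  [exact: (sa i)|exact: (sb j)].
Qed.

End VectorCurves.

Lemma TI_ddt_fst (R : comNzRingType) (f f' f'' k k' k'' : R) :
  f' * k' + f * k'' - (k' * f' + k * f'') = f * k'' - k * f''.
Proof. ring. Qed.

Lemma TI_jacobi_fst (R : comNzRingType) (f f' f'' k k' k'' m m' m'' : R) :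
  f * (k * m'' - m * k'') - (k * m' - m * k') * f'
  + (k * (m * f'' - f * m'') - (m * f' - f * m') * k')
  + (m * (f * k'' - k * f'') - (f * k' - k * f') * m') = 0.
Proof. ring. Qed.

Lemma TI_jacobi_snd (R : fieldType) (g : lieAlgType R)
    (f f' k k' m m' : R) (x x' x'' y y' y'' z z' z'' : g) :
  lie x (lie y z + k *: z' - m *: y')
  + f *: (lie y' z + lie y z' + (k' *: z' + k *: z'') - (m' *: y' + m *: y''))
  - (k * m' - m * k') *: x'
  + (lie y (lie z x + m *: x' - f *: z')
     + k *: (lie z' x + lie z x' + (m' *: x' + m *: x'')
             - (f' *: z' + f *: z''))
     - (m * f' - f * m') *: y')
  + (lie z (lie x y + f *: y' - k *: x')
     + m *: (lie x' y + lie x y' + (f' *: y' + f *: y'')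
             - (k' *: x' + k *: x''))
     - (f * k' - k * f') *: z') = 0.
Proof.
apply: coord_inj => i; pose l (v : g) : R := coord (vbasis {:g}) i v.
rewrite -/(l _) -/(l 0).
have lD u v : l (u + v) = l u + l v by rewrite /l linearD.
have lN u : l (- u) = - l u by rewrite /l linearN.
have lZ c u : l (c *: u) = c * l u by rewrite /l linearZ.
have l0 : l 0 = 0 by rewrite /l linear0.
have := congr1 l (lie_jacobi x y z).
rewrite !(lieDr, lieNr, lieZr) !(lD, lN, lZ, l0).
rewrite (lieC y' z) (lieC z' x) (lieC x' y) !lN => J.
rewrite -[RHS]J; ring.
Qed.

Lemma TI_linear_snd (R : comNzRingType) (V : lmodType R) (k f f' c : R)
    (u v x y z : V) :
  k *: u + v + (k * f + f') *: z - c *: (k *: x + y)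
  = k *: (u + f *: z - c *: x) + (v + f' *: z - c *: y).
Proof.
rewrite !scalerDr scalerDl scalerN opprD !scalerA [c * k]mulrC.
by rewrite [RHS]addrACA; congr (_ + _); exact: addrACA.
Qed.

Lemma TI_leibniz_snd (R : comNzRingType) (V : lmodType R) (u u' f k : R)
    (v x y y' : V) :
  u *: v + f *: (u' *: y + u *: y') - (u * k) *: x
  = u *: (v + f *: y' - k *: x) + (f * u') *: y.
Proof.
rewrite !scalerDr scalerN !scalerA [f * u]mulrC.
by rewrite [u *: v + (_ + _)]addrCA -addrA addrC.
Qed.

Section TangentTimesLie.
Context {R : realType} (I : open_interval R) (g : lieAlgType R).
Local Notation M := (interval_space I).
Local Notation E := (R^o * g)%type.

(* The vector r d/dt at s of TI is represented by r, so (r, x) in the fibre of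
   TI x g over s is r d/dt|_s + x. *)
Definition TI_anchor (s : M) (v : E) (u : M -> R) : R := v.1 * ddt u s.

Definition TI_bracket (a b : M -> E) : M -> E := fun s =>
  let f t := (a t).1 in let x t := (a t).2 in
  let k t := (b t).1 in let y t := (b t).2 in
  (f s * ddt k s - k s * ddt f s,
   lie (x s) (y s) + f s *: ddtv y s - k s *: ddtv x s).

Let sfst (a : M -> E) : smooth_vec a -> smooth_on (fun s : I => (a s).1 : R).
Proof. by move=> /smooth_vec_fst/smooth_vec_scalar. Qed.

Let slie (x y : M -> g) : smooth_vec x -> smooth_vec y ->
  smooth_vec (fun s => lie (x s) (y s)).
Proof. apply: smooth_vec_bilinear; [exact: lie_linearl|exact: lie_linearr]. Qed.

Fact TI_anchor_linear (p : M) (k : R) (v w : E) (u : M -> R) : Cinf u ->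
  TI_anchor p (k *: v + w) u = k * TI_anchor p v u + TI_anchor p w u.
Proof. by move=> _; rewrite /TI_anchor mulrDl -mulrA. Qed.

Fact TI_anchor_tangent (p : M) (v : E) : tangent_vector p (TI_anchor p v).
Proof.
rewrite /TI_anchor; split=> [u w su sw|k u su|u w su sw].
- rewrite (ddtD (smooth_differentiable su) (smooth_differentiable sw)).
  exact: mulrDr.
- rewrite ddtM; [|exact: differentiable_cst|exact: smooth_differentiable].
  by rewrite ddt_cst mul0r add0r mulrCA.
- rewrite (ddtM (smooth_differentiable su) (smooth_differentiable sw)); ring.
Qed.

Fact TI_anchor_smooth (a : M -> E) (u : M -> R) :
  smooth_vec a -> Cinf u -> Cinf (fun p => TI_anchor p (a p) u).
Proof.
by move=> sa su; apply: (@Cinf_mul _ M); [exact: sfst|exact: smooth_ddt].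
Qed.

Let sfst_bracket (a b : M -> E) : smooth_vec a -> smooth_vec b ->
  smooth_on (fun s : I => (a s).1 * ddt (fun t => (b t).1) s
                          - (b s).1 * ddt (fun t => (a t).1) s : R).
Proof.
move=> /sfst sa /sfst sb; have sa' := smooth_ddt sa; have sb' := smooth_ddt sb.
exact: (@Cinf_sub _ M _ _ (smoothM sa sb') (smoothM sb sa')).
Qed.

Fact TI_bracket_smooth (a b : M -> E) :
  smooth_vec a -> smooth_vec b -> smooth_vec (TI_bracket a b).
Proof.
move=> sa sb; have sa2 := smooth_vec_snd sa; have sb2 := smooth_vec_snd sb.
apply: smooth_vec_pair; first by apply/smooth_vec_scalar/sfst_bracket.
have sa1 := sfst sa; have sb1 := sfst sb.
have da := smooth_ddtv sa2; have db := smooth_ddtv sb2.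
apply: (smooth_vecB (smooth_vecD (slie sa2 sb2) _)).
  exact: (@smooth_vecZ _ M _ _ _ sa1 db).
exact: (@smooth_vecZ _ M _ _ _ sb1 da).
Qed.

Fact TI_bracket_linearl (k : R) (a b c : M -> E) :
  smooth_vec a -> smooth_vec b -> smooth_vec c ->
  forall p, TI_bracket (fun q => k *: a q + b q) c p
            = k *: TI_bracket a c p + TI_bracket b c p.
Proof.
move=> sa sb sc p; rewrite /TI_bracket; congr (_, _) => /=.
  rewrite ddtD; [|apply: differentiableM; [exact: differentiable_cst|]|];
    [|exact: smooth_differentiable (sfst sa)|exact: smooth_differentiable (sfst sb)].
  rewrite ddtM; [|exact: differentiable_cst|exact: smooth_differentiable (sfst sa)].
  rewrite ddt_cst /GRing.scale /=; ring.
have sa2 := smooth_vec_snd sa; have sb2 := smooth_vec_snd sb.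
rewrite (ddtvD (smooth_vecZ (Cinf_cst M k) sa2) sb2).
rewrite (ddtvZ (Cinf_cst M k) sa2) ddt_cst scale0r add0r lieDl lieZl.
exact: TI_linear_snd.
Qed.

Fact TI_bracket_alt (a : M -> E) : smooth_vec a ->
  forall p, TI_bracket a a p = 0.
Proof.
by move=> _ p; rewrite /TI_bracket liexx add0r !subrr.
Qed.

Let ddt_fst_bracket (u v : M -> E) s : smooth_vec u -> smooth_vec v ->
  ddt (fun t => (TI_bracket u v t).1) s
  = (u s).1 * ddt (ddt (fun t => (v t).1)) s
    - (v s).1 * ddt (ddt (fun t => (u t).1)) s.
Proof.
move=> /sfst su /sfst sv; have su' := smooth_ddt su; have sv' := smooth_ddt sv.
rewrite /TI_bracket /= (ddtB (smoothM su sv') (smoothM sv su')).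
rewrite (ddtM (smooth_differentiable su) (smooth_differentiable sv')).
rewrite (ddtM (smooth_differentiable sv) (smooth_differentiable su')).
exact: TI_ddt_fst.
Qed.

Let ddt_snd_bracket (u v : M -> E) s : smooth_vec u -> smooth_vec v ->
  ddtv (fun t => (TI_bracket u v t).2) s
  = lie (ddtv (fun t => (u t).2) s) (v s).2
    + lie (u s).2 (ddtv (fun t => (v t).2) s)
    + (ddt (fun t => (u t).1) s *: ddtv (fun t => (v t).2) s
       + (u s).1 *: ddtv (ddtv (fun t => (v t).2)) s)
    - (ddt (fun t => (v t).1) s *: ddtv (fun t => (u t).2) s
       + (v s).1 *: ddtv (ddtv (fun t => (u t).2)) s).
Proof.
move=> su sv; have su2 := smooth_vec_snd su; have sv2 := smooth_vec_snd sv.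
have su1 := sfst su; have sv1 := sfst sv.
have du := smooth_ddtv su2; have dv := smooth_ddtv sv2.
have zv := @smooth_vecZ _ M _ _ _ su1 dv; have zu := @smooth_vecZ _ M _ _ _ sv1 du.
rewrite /TI_bracket /= (ddtvB (smooth_vecD (slie su2 sv2) zv) zu).
rewrite (ddtvD (slie su2 sv2) zv).
rewrite (@ddtvZ _ _ _ _ _ su1 dv) (@ddtvZ _ _ _ _ _ sv1 du).
by rewrite (ddtv_bilinear (@lie_linearl _ g) (@lie_linearr _ g) su2 sv2).
Qed.

Fact TI_bracket_jacobi (a b c : M -> E) :
  smooth_vec a -> smooth_vec b -> smooth_vec c ->
  forall p, TI_bracket a (TI_bracket b c) p + TI_bracket b (TI_bracket c a) p
            + TI_bracket c (TI_bracket a b) p = 0.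
Proof.
move=> sa sb sc p.
have bE (u v : M -> E) s : TI_bracket u v s =
  ((u s).1 * ddt (fun t => (v t).1) s - (v s).1 * ddt (fun t => (u t).1) s,
   lie (u s).2 (v s).2 + (u s).1 *: ddtv (fun t => (v t).2) s
   - (v s).1 *: ddtv (fun t => (u t).2) s) by [].
rewrite (bE a) (bE b (TI_bracket c a)) (bE c (TI_bracket a b)).
rewrite !ddt_snd_bracket ?ddt_fst_bracket; try assumption.
rewrite !bE; congr (_, _).
  exact: TI_jacobi_fst.
exact: TI_jacobi_snd.
Qed.

Fact TI_bracket_leibniz (a b : M -> E) (u : M -> R) :
  smooth_vec a -> smooth_vec b -> Cinf u ->
  forall p, TI_bracket a (fun q => u q *: b q) p
            = u p *: TI_bracket a b p + TI_anchor p (a p) u *: b p.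
Proof.
move=> sa sb su p; rewrite /TI_bracket /TI_anchor; congr (_, _) => /=.
  have du := smooth_differentiable su.
  rewrite (ddtM du (smooth_differentiable (sfst sb))) /GRing.scale /=; ring.
rewrite (ddtvZ su (smooth_vec_snd sb)) lieZr.
exact: TI_leibniz_snd.
Qed.

Definition tangent_times : lie_algebroid M :=
  LieAlgebroid TI_anchor_linear TI_anchor_tangent TI_anchor_smooth
    TI_bracket_smooth TI_bracket_linearl TI_bracket_alt TI_bracket_jacobi
    TI_bracket_leibniz.

End TangentTimesLie.

(* (0, x) in the fibre over s is (0|_s, x). *)
Definition LA_homotopy (R : realType) (I : open_interval R)
    (I0 : 0 \in itv_set I) (I1 : 1 \in itv_set I)
    (g h : lieAlgType R) (Phi0 Phi1 : g -> h)
    (Phi : I -> R^o * g -> h) (phi : I -> unit) :=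
  let i0 : I := exist _ 0 I0 in
  let i1 : I := exist _ 1 I1 in
  [/\ lie_morphism Phi0, lie_morphism Phi1,
      @LA_morphism R (interval_space I) point_space
        (tangent_times I g) (algebroid_of_lie h) Phi phi,
      forall x, Phi i0 (0, x) = Phi0 x
    & forall x, Phi i1 (0, x) = Phi1 x].

(* Main.v *)
Require Import Defs.
From HB Require Import structures.
From mathcomp Require Import all_boot all_order all_algebra.
From mathcomp Require Import all_classical all_reals all_analysis.
From mathcomp Require Import ring lra.
Set Implicit Arguments.
Unset Strict Implicit.
Unset Printing Implicit Defensive.
Import Order.TTheory GRing.Theory Num.Theory.
Import numFieldNormedType.Exports.
Local Open Scope classical_set_scope.
Local Open Scope ring_scope.

(** Splitting the fibre R x g writes every bundle morphism uniquely as
    Phi_s(r, x) = r c(s) + psi_s(x) with smooth c and psi, so the content is the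
    translation of the bracket condition into conditions on c and psi; the
    anchor condition is void because h has zero anchor.

    The bracket condition is stated with arbitrary decompositions of Phi o a_1
    and Phi o a_2 in the pullback bundle.  That bundle is I x h with the base
    sections as constants, so a decomposition only expresses the h-valued curve
    Phi o a as a combination of constant vectors, and differentiating the
    coefficients differentiates the curve.  The condition is thus
      Phi [a_1, a_2] = [Phi a_1, Phi a_2]
                       + f_1 (Phi a_2)' - f_2 (Phi a_1)',
    where f_i is the d/dt component of a_i ([bracket_compatibleP]).

    On the constant sections (0, x), (0, y) this says that every psi_s is a
    morphism of Lie algebras, and on (d/dt, 0), (0, x), whose bracket vanishes,
    it says 0 = [c, psi x] + (psi x)', the differential equation.

    Conversely, suppose the differential equation holds and psi_0 is a morphism.
    As ad_c is a derivation, the defect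
      D = psi [x, y] - [psi x, psi y]
    satisfies the linear equation D' = - [c, D] with D(0) = 0, so it vanishes
    on all of I ([lie_morphism_propagates]).  Then for
    Phi o a_i = f_i c + psi(x_i) the bracket condition is an algebraic identity
    ([lie_homotopy_identity]).

    Uniqueness for a linear equation v' = A v ([linear_ode_eq0]) comes from a
    Gronwall estimate for the squared norm of v in coordinates. *)

(** * Gronwall estimates on a segment *)

(** The weight exp(- K t) turns the bound f' <= K f into monotonicity. *)
Lemma gronwall_le0_right (R : realType) (f f' : R -> R) (K a b : R) :
  a <= b -> {in `[a, b], forall t : R, is_derive t 1 f (f' t)} ->
  {in `[a, b], forall t : R, f' t <= K * f t} -> f a <= 0 -> f b <= 0.
Proof.
move=> ab df f'_le fa.
pose w t : R := expR (- K * t) * f t.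
have dw t : t \in `[a, b] -> is_derive t 1 w (expR (- K * t) * (f' t - K * f t)).
  move=> /df dft; rewrite /w.
  apply: is_derive_eq; rewrite /GRing.scale /=; ring.
have wab : w b <= w a.
  apply: (@ler0_derive1_le_cc _ w a b) => //; last 2 first.
  - by rewrite in_itv /= lexx ab.
  - by rewrite in_itv /= lexx ab.
  - by move=> t tab; have [] := dw _ (subset_itv_oo_cc tab).
  - move=> t /subset_itv_oo_cc tab; have [_] := dw _ tab; rewrite derive1E => ->.
    by rewrite mulr_ge0_le0 ?expR_ge0// subr_le0 f'_le.
  - by apply: derivable_within_continuous => t tab; have [] := dw _ tab.
rewrite -(pmulr_rle0 (f b) (expR_gt0 (- K * b))) (le_trans wab)//.
by rewrite pmulr_rle0 ?expR_gt0.
Qed.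

(** Time reversal of the preceding estimate: the initial point of the linear
    equations below is interior to the interval. *)
Lemma gronwall_le0_left (R : realType) (f f' : R -> R) (K a b : R) :
  a <= b -> {in `[a, b], forall t : R, is_derive t 1 f (f' t)} ->
  {in `[a, b], forall t : R, - (K * f t) <= f' t} -> f b <= 0 -> f a <= 0.
Proof.
move=> ab df f'_ge fb; rewrite -(opprK a).
apply: (@gronwall_le0_right _ (f \o -%R) (fun t => - f' (- t)) K (- b)); rewrite ?lerN2 /= ?opprK//.
- move=> t; rewrite -oppr_itvcc => /df dft.
  by apply: is_derive_eq; rewrite mulrN1.
- by move=> t; rewrite -oppr_itvcc => /f'_ge; rewrite lerNl.
Qed.

(** * Linear differential equations on an open interval *)

Section LinearODE.
Context {R : realType} {I : open_interval R}.
Local Notation M := (interval_space I).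

Lemma sub_itv (a b : I) : `[val a, val b] `<=` itv_set I.
Proof.
move=> t /=; rewrite in_itv /=; apply: itv_interval; apply: set_mem; exact: valP.
Qed.

Lemma is_derive_ext0 (u : I -> R) (t : R) : smooth_on u -> itv_set I t ->
  is_derive t 1 ('valL_0 u) (derive1 ('valL_0 u) t).
Proof.
move=> su /mem_set It.
by rewrite derive1E; apply/derivableP; exact: (@smooth_differentiable _ _ u su (exist _ t It)).
Qed.

(** A smooth function on I need not be bounded; the constant K of a Gronwall
    estimate exists only on the compact segment joining two points. *)
Lemma segment_bounded (u : I -> R) (a b : I) : smooth_on u -> val a <= val b ->
  exists K, forall s : I, val s \in `[val a, val b] -> u s <= K.
Proof.
move=> su ab.
have cu : {within `[val a, val b], continuous ('valL_0 u)}.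
  apply: derivable_within_continuous => t /sub_itv It.
  by have [] := is_derive_ext0 su It.
have [c _ cmax] := EVT_max ab cu.
by exists ('valL_0 u c) => s sab; rewrite -(ext0E u s) cmax.
Qed.

Lemma gronwall_eq0 (E k : I -> R) (s0 : I) : smooth_on E -> smooth_on k ->
  (forall s, 0 <= E s) -> (forall s, `|ddt E s| <= k s * E s) -> E s0 = 0 ->
  forall s, E s = 0.
Proof.
move=> sE sk E_ge0 E'_le Es0 s; apply/le_anti; rewrite E_ge0 andbT.
pose f := 'valL_0 E : R -> R.
have f_E (r : I) : f (val r) = E r by exact: ext0E.
have df (a b : I) : {in `[val a, val b], forall t : R, is_derive t 1 f (derive1 f t)}.
  by move=> t /sub_itv; exact: is_derive_ext0.
have bound (a b : I) : val a <= val b ->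
    exists K, {in `[val a, val b], forall t, `|derive1 f t| <= K * f t}.
  move=> /(segment_bounded sk)[K kK]; exists K => t tab.
  have It : t \in itv_set I by apply: mem_set; exact: sub_itv tab.
  have := E'_le (exist _ t It); rewrite /ddt -/f /= => /le_trans; apply.
  rewrite -(f_E (exist _ t It)) /= ler_wpM2r ?(f_E (exist _ t It))//.
  exact: kK.
rewrite -f_E; have [le_s|/ltW le_s] := leP (val s0) (val s).
- have [K fK] := bound _ _ le_s.
  apply: (gronwall_le0_right (K := K) le_s (df _ _)); last by rewrite f_E Es0.
  by move=> t /fK; apply: le_trans; exact: ler_norm.
- have [K fK] := bound _ _ le_s.
  apply: (gronwall_le0_left (K := K) le_s (df _ _)); last by rewrite f_E Es0.
  by move=> t /fK; rewrite ler_norml => /andP[].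
Qed.

Lemma ddt_sum n (u : 'I_n -> I -> R) : (forall i, smooth_on (u i)) ->
  ddt (fun s => \sum_(i < n) u i s) = fun s => \sum_(i < n) ddt (u i) s.
Proof.
elim: n u => [|n IHn] u su.
  under eq_fun do rewrite big_ord0.
  by rewrite ddt_cst; apply/funext => s; rewrite big_ord0.
under eq_fun do rewrite big_ord_recl.
have s0 := smooth_differentiable (su ord0).
have s1 := smooth_differentiable (@Cinf_sum _ M _ _ (fun i => su (lift ord0 i))).
rewrite (ddtD s0 s1).
by rewrite IHn//; apply/funext => s; rewrite big_ord_recl.
Qed.

(** In coordinates x_i of v and a_ij of A, the squared norm E = sum_i x_i^2 has
    E' = 2 sum_ij a_ij x_i x_j, and 2 |a x_i x_j| <= x_i^2 + a^2 x_j^2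
    <= (1 + a^2) E.  The factor 1 + a^2 is preferred to |a| because it is again
    smooth. *)
Lemma linear_ode_eq0 (V : vectType R) (A : I -> V -> V) (v : I -> V) (s0 : I) :
  (forall s, linear (A s)) ->
  (forall x, @smooth_vec R M V (fun s => A s x)) -> @smooth_vec R M V v ->
  (forall s, ddtv v s = A s (v s)) -> v s0 = 0 -> forall s, v s = 0.
Proof.
move=> lA sA sv v' vs0.
pose x i s : R := coord (vbasis {:V}) i (v s).
pose a i (j : 'I_(\dim {:V})) s : R := coord (vbasis {:V}) i (A s (vbasis {:V})`_j).
pose E s := \sum_i x i s * x i s.
pose k s := \sum_i \sum_j (1 + a i j s * a i j s).
have sx i : smooth_on (x i) by exact: sv.
have sxx i : smooth_on (fun s => x i s * x i s) by exact: smoothM.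
have x' i s : ddt (x i) s = \sum_j a i j s * x j s.
  rewrite -coord_ddtv v' [in LHS](coord_comb (v s)) linear_comb// linear_sum /=.
  by apply: eq_bigr => j _; rewrite linearZ mulrC.
have E' s : ddt E s = \sum_i \sum_j (a i j s * x j s * x i s) *+ 2.
  rewrite ddt_sum//; apply: eq_bigr => i _.
  rewrite ddtM; [|exact: smooth_differentiable..].
  by rewrite [X in _ + X]mulrC -mulr2n x' mulr_suml -sumrMnl.
have E_ge s i : x i s ^+ 2 <= E s.
  rewrite expr2 /E (bigD1 i)//= lerDl sumr_ge0// => j _.
  by rewrite -expr2 sqr_ge0.
suff E0 s : E s = 0.
  move=> s; apply: coord_inj => i; rewrite linear0; apply/eqP.
  by rewrite -sqrf_eq0 eq_le sqr_ge0 andbT -(E0 s) E_ge.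
move: s; apply: (@gronwall_eq0 E k s0).
- exact: (@Cinf_sum _ M _ (fun i s => x i s * x i s)).
- apply: (@Cinf_sum _ M) => i; apply: (@Cinf_sum _ M) => j.
  by apply: (@Cinf_add _ M); [exact: Cinf_cst|apply: (@Cinf_mul _ M); exact: sA].
- by move=> s; apply: sumr_ge0 => i _; rewrite -expr2 sqr_ge0.
- move=> s; rewrite E' /k mulr_suml (le_trans (ler_norm_sum _ _ _))//.
  apply: ler_sum => i _; rewrite mulr_suml (le_trans (ler_norm_sum _ _ _))//.
  apply: ler_sum => j _.
  have := E_ge s i; have := E_ge s j; rewrite ler_norml.
  have := sqr_ge0 (a i j s); have := sqr_ge0 (x i s - a i j s * x j s).
  have := sqr_ge0 (x i s + a i j s * x j s).
  move: (a i j s) (x i s) (x j s) (E s) => b y z e h1 h2 h3 h4 h5.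
  have h6 : 0 <= b ^+ 2 * (e - z ^+ 2) by rewrite mulr_ge0// subr_ge0.
  by apply/andP; split; nra.
- by rewrite /E big1// => i _; rewrite /x vs0 linear0 mul0r.
Qed.

End LinearODE.

(** * Smooth families of linear maps *)

Section LinearFamilies.
Context {R : realType} {V W : vectType R}.

Lemma linfun_linearE (f : V -> W) : linear f -> linfun f =1 f.
Proof.
move=> lf; pose F : {linear V -> W} :=
  HB.pack_for {linear V -> W} f (GRing.isLinear.Build R V W *:%R f lf).
exact: (lfunE F).
Qed.

Lemma eval_linearl (x : V) : linear (fun f : 'Hom(V, W) => f x).
Proof. by move=> k f f'; rewrite add_lfunE scale_lfunE. Qed.

(** Smoothness in the space of homomorphisms is tested in a basis that its
    vector space structure provides and that has no given link with the bases of
    V and W; expanding psi in the matrix units of these bases, which are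
    constant, avoids a comparison of bases. *)
Lemma smooth_vec_Hom (M : smooth_space R) (psi : M -> 'Hom(V, W)) :
  (forall x, smooth_vec (fun p => psi p x)) -> smooth_vec psi.
Proof.
move=> spsi.
pose unit_hom (i : 'I_(\dim {:V})) (j : 'I_(\dim {:W})) : 'Hom(V, W) :=
  linfun (fun x => coord (vbasis {:V}) i x *: (vbasis {:W})`_j).
have unit_homE i j x :
    unit_hom i j x = coord (vbasis {:V}) i x *: (vbasis {:W})`_j.
  by apply: linfun_linearE => k y z; rewrite linearP scalerDl scalerA.
have -> : psi = fun p => \sum_(i < \dim {:V}) \sum_(j < \dim {:W})
    coord (vbasis {:W}) j (psi p (vbasis {:V})`_i) *: unit_hom i j.
  apply/funext => p; apply/lfunP => x.
  rewrite [in LHS](coord_comb x) linear_sum sum_lfunE; apply: eq_bigr => i _.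
  rewrite sum_lfunE linearZ /= [in LHS](coord_comb (psi p _)) scaler_sumr.
  by apply: eq_bigr => j _; rewrite scale_lfunE unit_homE !scalerA mulrC.
by apply: smooth_vec_sum => i; apply: smooth_vec_comb => j; exact: spsi.
Qed.

Lemma smooth_vec_app (M : smooth_space R) (F : M -> V -> W) (a : M -> V) :
  (forall p, linear (F p)) -> (forall v, smooth_vec (fun p => F p v)) ->
  smooth_vec a -> smooth_vec (fun p => F p (a p)).
Proof.
move=> lF sF sa; under eq_fun do rewrite (coord_comb (a _)) linear_comb//.
by apply: smooth_vec_sum => i; apply: smooth_vecZ.
Qed.

Lemma ddtv_eval (I : open_interval R) (psi : I -> 'Hom(V, W)) (a : I -> V) s :
  @smooth_vec R (interval_space I) _ psi -> @smooth_vec R (interval_space I) _ a ->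
  ddtv (fun t => psi t (a t)) s = ddtv psi s (a s) + psi s (ddtv a s).
Proof.
move=> spsi sa.
rewrite (@ddtv_bilinear _ _ _ _ _ (fun (f : 'Hom(V, W)) x => f x) psi a)//; first exact: eval_linearl.
by move=> f k x y; rewrite linearP.
Qed.

End LinearFamilies.

(** * The bracket condition over a point *)

Section BracketCompatibility.
Context {R : realType} {I : open_interval R} {g h : lieAlgType R}.
Local Notation M := (interval_space I).
Local Notation A := (tangent_times I g).
Local Notation B := (algebroid_of_lie h).
Variables (Phi : I -> R^o * g -> h) (phi : I -> unit).

(** The base sections of a decomposition are pulled back from a point, so they
    are constant along I and only the coefficients get differentiated. *)
Lemma ddtv_decomposition (a : M -> fiber A) n (u : 'I_n -> M -> R)
    (b : 'I_n -> point_space -> fiber B) (p : M) :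
  @decomposition R M point_space A B Phi phi a n u b ->
  ddtv (fun q => Phi q (a q)) p = \sum_(i < n) ddt (u i) p *: b i (phi p).
Proof.
case=> su _ Pa.
have -> : (fun q => Phi q (a q)) = fun q => \sum_(i < n) u i q *: b i (phi p).
  apply/funext => q; rewrite Pa; apply: eq_bigr => i _.
  by case: (phi q) (phi p) => -[].
by rewrite (@ddtv_comb _ _ _ n u (fun i => b i (phi p))).
Qed.

(** The pullback formula for the bracket does not depend on the decompositions:
    each of its three sums is the value of an expression in Phi o a1 and
    Phi o a2 alone. *)
Lemma bracket_decomposition (a1 a2 : M -> fiber A)
    n1 (u1 : 'I_n1 -> M -> R) (b1 : 'I_n1 -> point_space -> fiber B)
    n2 (u2 : 'I_n2 -> M -> R) (b2 : 'I_n2 -> point_space -> fiber B) (p : M) :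
  @decomposition R M point_space A B Phi phi a1 n1 u1 b1 ->
  @decomposition R M point_space A B Phi phi a2 n2 u2 b2 ->
  \sum_(i < n1) \sum_(j < n2) (u1 i p * u2 j p) *: bracket (b1 i) (b2 j) (phi p)
  + \sum_(j < n2) anchor p (a1 p) (u2 j) *: b2 j (phi p)
  - \sum_(i < n1) anchor p (a2 p) (u1 i) *: b1 i (phi p)
  = lie (Phi p (a1 p)) (Phi p (a2 p))
    + (a1 p).1 *: ddtv (fun q => Phi q (a2 q)) p
    - (a2 p).1 *: ddtv (fun q => Phi q (a1 q)) p :> h.
Proof.
move=> d1 d2; rewrite (ddtv_decomposition p d1) (ddtv_decomposition p d2).
have [_ _ P1] := d1; have [_ _ P2] := d2.
congr (_ + _ - _); last 2 first.
- by rewrite scaler_sumr; apply: eq_bigr => j _; rewrite scalerA.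
- by rewrite scaler_sumr; apply: eq_bigr => i _; rewrite scalerA.
rewrite P1 P2.
rewrite (@linear_comb _ _ _ (fun v => lie v _) _ (fun i => u1 i p)); last exact: lie_linearl.
apply: eq_bigr => i _.
rewrite (@linear_comb _ _ _ (lie _) _ (fun j => u2 j p)); last exact: lie_linearr.
by rewrite scaler_sumr; apply: eq_bigr => j _; rewrite scalerA.
Qed.

(** With the decompositions eliminated, the bracket condition becomes an equation
    between curves in h.  The bundle morphism hypothesis serves to supply one
    decomposition of each section, by the coordinates of Phi o a. *)
Lemma bracket_compatibleP :
  @bundle_morphism R M point_space A B Phi phi ->
  @bracket_compatible R M point_space A B Phi phi <->
  forall a1 a2 : M -> fiber A, smooth_vec a1 -> smooth_vec a2 ->
  forall p, Phi p (bracket a1 a2 p) =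
    lie (Phi p (a1 p)) (Phi p (a2 p))
    + (a1 p).1 *: ddtv (fun q => Phi q (a2 q)) p
    - (a2 p).1 *: ddtv (fun q => Phi q (a1 q)) p.
Proof.
case=> _ lPhi sPhi; split=> [Phi_br a1 a2 s1 s2 p|
    Phi_br a1 a2 s1 s2 n1 u1 b1 n2 u2 b2 d1 d2 p]; last first.
  by rewrite Phi_br// (bracket_decomposition p d1 d2).
pose u (a : M -> fiber A) (i : 'I_(\dim {:h})) (q : M) : R :=
  coord (vbasis {:h}) i (Phi q (a q)).
pose b (i : 'I_(\dim {:h})) (_ : @point_space R) := (vbasis {:h})`_i : fiber B.
have dec a : smooth_vec a -> @decomposition R M point_space A B Phi phi a _ (u a) b.
  move=> sa; split=> [i||q]; last exact: coord_comb.
  + exact: (@smooth_vec_app _ _ _ M Phi a).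
  + by move=> i j.
rewrite (Phi_br _ _ s1 s2 _ _ _ _ _ _ (dec _ s1) (dec _ s2)).
exact: bracket_decomposition (dec _ s1) (dec _ s2).
Qed.

End BracketCompatibility.

(** * From the differential equation to the bracket condition *)

Lemma lie_derivation (R : fieldType) (h : lieAlgType R) (z x y : h) :
  lie z (lie x y) = lie (lie z x) y + lie x (lie z y).
Proof.
have := lie_jacobi z x y; rewrite (lieC y z) (lieC y (lie z x)) lieNr => J.
by apply: subr0_eq; rewrite opprD addrA addrAC.
Qed.

(** The bracket condition at a point s, for Phi a_1 = f z + x and
    Phi a_2 = k z + y where z = c(s), x = psi_s(x_1), y = psi_s(x_2); the
    derivatives of the psi parts contribute - [z, x] + x' and - [z, y] + y' by
    the differential equation and the product rule, and these brackets cancel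
    the mixed terms of [Phi a_1, Phi a_2]. *)
Lemma lie_homotopy_identity (R : fieldType) (h : lieAlgType R)
    (f f' k k' : R) (z z' x x' y y' : h) :
  (f * k' - k * f') *: z + (lie x y + f *: y' - k *: x')
  = lie (f *: z + x) (k *: z + y)
    + f *: (k' *: z + k *: z' + (- lie z y + y'))
    - k *: (f' *: z + f *: z' + (- lie z x + x')).
Proof.
rewrite !(lieDl, lieDr, lieZl, lieZr) liexx (lieC x z) !scaler0 add0r.
apply: coord_inj => i; pose l (v : h) : R := coord (vbasis {:h}) i v.
rewrite -!/(l _).
have lD u v : l (u + v) = l u + l v by rewrite /l linearD.
have lN u : l (- u) = - l u by rewrite /l linearN.
have lZ a u : l (a *: u) = a * l u by rewrite /l linearZ.
rewrite !(lD, lN, lZ); ring.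
Qed.

Section NormalForm.
Context {R : realType} {I : open_interval R} {g h : lieAlgType R}.
Local Notation M := (interval_space I).
Local Notation A := (tangent_times I g).
Local Notation B := (algebroid_of_lie h).
Variables (c : I -> h) (psi : I -> 'Hom(g, h)).
Hypothesis sc : @smooth_vec R M h c.
Hypothesis spsi : @smooth_vec R M 'Hom(g, h) psi.
Hypothesis psi_ode : forall s x, (ddtv psi s : 'Hom(g, h)) x = - lie (c s) (psi s x).

(** The failure of psi to respect the bracket of x and y solves D' = - [c, D],
    because ad_c is a derivation; it vanishes at s0, hence everywhere. *)
Lemma lie_morphism_propagates (s0 : I) :
  lie_morphism (psi s0) -> forall s, lie_morphism (psi s).
Proof.
case=> _ psi_s0 s; split=> [k v w|x y]; first exact: linearP.
apply: subr0_eq.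
have spsix v : @smooth_vec R M h (fun t => psi t v).
  exact: (smooth_vec_linear (@eval_linearl _ _ _ v) spsi).
have psi' v t : ddtv (fun q => psi q v) t = - lie (c t) (psi t v).
  by rewrite (ddtv_linear (@eval_linearl _ _ _ v) spsi) psi_ode.
have slie : @smooth_vec R M h (fun t => lie (psi t x) (psi t y)).
  by apply: smooth_vec_bilinear => //; [exact: lie_linearl|exact: lie_linearr].
apply: (@linear_ode_eq0 _ _ _ (fun t v => - lie (c t) v)
         (fun t => psi t (lie x y) - lie (psi t x) (psi t y)) s0).
- by move=> t k v w; rewrite lieDr lieZr opprD scalerN.
- move=> v.
  have lv : linear (fun w : h => - lie w v).
    by move=> k w w'; rewrite lieDl lieZl opprD scalerN.
  exact: smooth_vec_linear lv sc.
- exact: (smooth_vecB (spsix _) slie).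
- move=> t; rewrite (ddtvB (spsix _) slie) psi'.
  rewrite (ddtv_bilinear (@lie_linearl _ h) (@lie_linearr _ h) (spsix x) (spsix y)).
  rewrite !psi' lieDr [lie (c t) (- _)]lieNr lie_derivation.
  by rewrite [lie (- _) _]lieNl [lie (psi t x) (- _)]lieNr !opprD !opprK.
- by rewrite psi_s0 subrr.
Qed.

Variables (Phi : I -> R^o * g -> h) (phi : I -> unit).
Hypothesis PhiE : forall r s x, Phi s (r, x) = r *: c s + psi s x.

Lemma ddtv_normal_form (a : M -> fiber A) s : smooth_vec a ->
  ddtv (fun t => Phi t (a t)) s =
    ddt (fun t => (a t).1) s *: c s + (a s).1 *: ddtv c s
    + (- lie (c s) (psi s (a s).2) + psi s (ddtv (fun t => (a t).2) s)).
Proof.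
move=> sa; have s1 := (smooth_vec_scalar _).1 (smooth_vec_fst sa).
have s2 := smooth_vec_snd sa.
have -> : (fun t => Phi t (a t)) = fun t => (a t).1 *: c t + psi t (a t).2.
  by apply/funext => t; rewrite -PhiE; case: (a t).
have e_smooth := @smooth_vec_app _ _ _ M (fun t => psi t : g -> h) _
  (fun t => linearP (psi t)) (fun v => smooth_vec_linear (@eval_linearl _ _ _ v) spsi) s2.
rewrite (ddtvD (smooth_vecZ s1 sc) e_smooth) (ddtvZ s1 sc).
by rewrite (ddtv_eval _ spsi s2) psi_ode.
Qed.

Lemma bracket_compatible_normal_form :
  (forall s, lie_morphism (psi s)) ->
  @bundle_morphism R M point_space A B Phi phi ->
  @bracket_compatible R M point_space A B Phi phi.
Proof.
move=> psi_lie bPhi; apply/(bracket_compatibleP bPhi) => a1 a2 s1 s2 p.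
have PhiE2 v : Phi p v = v.1 *: c p + psi p v.2 by rewrite -PhiE; case: v.
have psi_lin x y z (f k : R) :
    psi p (x + f *: y - k *: z) = psi p x + f *: psi p y - k *: psi p z.
  by rewrite linearB linearD !linearZ.
rewrite !ddtv_normal_form// !PhiE2 /= psi_lin (psi_lie p).2.
exact: lie_homotopy_identity.
Qed.

End NormalForm.

(** * From the bracket condition to the differential equation *)

Section Homotopy.
Context {R : realType} {I : open_interval R} {g h : lieAlgType R}.
Local Notation M := (interval_space I).
Local Notation A := (tangent_times I g).
Local Notation B := (algebroid_of_lie h).
Variables (Phi : I -> R^o * g -> h) (phi : I -> unit).
Hypothesis bPhi : @bundle_morphism R M point_space A B Phi phi.

(** The target has zero anchor, and functions pulled back from a point are
    constant. *)
Lemma anchor_compatible_point : @anchor_compatible R M point_space A B Phi phi.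
Proof.
move=> p v u _ /=; rewrite /TI_anchor.
have -> : u \o phi = fun=> u tt by apply/funext => q /=; case: (phi q).
by rewrite ddt_cst mulr0.
Qed.

Lemma bundle_morphism_normal_form : exists (c : I -> h) (psi : I -> 'Hom(g, h)),
  [/\ @smooth_vec R M h c, @smooth_vec R M 'Hom(g, h) psi
    & forall (r : R) (s : I) (x : g), Phi s (r, x) = r *: c s + psi s x].
Proof.
have [_ lPhi sPhi] := bPhi.
have psiE s : linfun (fun x : g => Phi s (0, x)) =1 (fun x => Phi s (0, x)).
  apply: linfun_linearE => k x y.
  by rewrite -lPhi; congr (Phi s (_, _)); rewrite /= scaler0 addr0.
exists (fun s => Phi s (1, 0)), (fun s => linfun (fun x => Phi s (0, x))); split.
- exact: sPhi.
- by apply: smooth_vec_Hom => x; under eq_fun do rewrite psiE; exact: sPhi.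
- move=> r s x; rewrite psiE -lPhi; congr (Phi s (_, _)) => /=.
    by rewrite addr0 /GRing.scale /= mulr1.
  by rewrite scaler0 add0r.
Qed.

Variables (c : I -> h) (psi : I -> 'Hom(g, h)).
Hypothesis spsi : @smooth_vec R M 'Hom(g, h) psi.
Hypothesis PhiE : forall r s x, Phi s (r, x) = r *: c s + psi s x.
Hypothesis brPhi : @bracket_compatible R M point_space A B Phi phi.

Let sconst (v : R^o * g) : @smooth_vec R M (fiber A) (fun=> v).
Proof. exact: smooth_vec_cst. Qed.

(** Evaluation of the bracket condition on the constant sections (0, x) and
    (0, y), whose d/dt components vanish. *)
Lemma bracket_compatible_lie_morphism s : lie_morphism (psi s).
Proof.
split=> [k v w|x y]; first exact: linearP.
have := (bracket_compatibleP bPhi).1 brPhi _ _ (@sconst (0, x)) (@sconst (0, y)) s.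
rewrite /= /TI_bracket /= !ddtv_cst !scale0r !mul0r !subr0 !addr0.
by rewrite !PhiE !scale0r !add0r.
Qed.

(** Evaluation of the bracket condition on the constant sections d/dt and
    (0, x), which commute. *)
Lemma bracket_compatible_ode s x :
  (ddtv psi s : 'Hom(g, h)) x = - lie (c s) (psi s x).
Proof.
have := (bracket_compatibleP bPhi).1 brPhi _ _ (@sconst (1, 0)) (@sconst (0, x)) s.
rewrite /= /TI_bracket /= !ddtv_cst !ddt_cst lie0l !scaler0 !mulr0 !subr0 !addr0.
rewrite scale0r scale1r subr0 !PhiE !scale0r !scale1r !add0r.
have -> : psi s 0 = 0 by rewrite linear0.
rewrite addr0.
have -> : (fun q => Phi q (0, x)) = fun q => psi q x.
  by apply/funext => q; rewrite PhiE scale0r add0r.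
rewrite (ddtv_linear (@eval_linearl _ _ _ x) spsi) => /esym/eqP.
by rewrite addrC addr_eq0 => /eqP.
Qed.

End Homotopy.

(** * The characterisation of homotopies *)

Theorem proposition4p1 (R : realType) (I : open_interval R)
    (I0 : 0 \in itv_set I) (I1 : 1 \in itv_set I)
    (g h : lieAlgType R)
    (Phi : I -> R^o * g -> h) (phi : I -> unit)
    (hPhi : @bundle_morphism R (interval_space I) point_space
              (tangent_times I g) (algebroid_of_lie h) Phi phi) :
  let i0 : I := exist _ 0 I0 in
  let i1 : I := exist _ 1 I1 in
  let normal_form :=
    exists (c : I -> h) (psi : I -> 'Hom(g, h)),
      [/\ @smooth_vec R (interval_space I) h c,
          @smooth_vec R (interval_space I) 'Hom(g, h) psi,
          lie_morphism (psi i0),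
          forall (r : R) (s : I) (x : g), Phi s (r, x) = r *: c s + psi s x
        & forall (s : I) (x : g),
            (ddtv psi s : 'Hom(g, h)) x = - lie (c s) (psi s x)] in
  (@LA_morphism R (interval_space I) point_space
     (tangent_times I g) (algebroid_of_lie h) Phi phi <-> normal_form)
  /\ (LA_homotopy I0 I1 (fun x => Phi i0 (0, x)) (fun x => Phi i1 (0, x))
        Phi phi <-> normal_form).
Proof.
move=> i0 i1 normal_form.
(* For an LA-morphism the two ends are automatically morphisms, so both
   equivalences reduce to the first. *)
have LA_lie : @LA_morphism R (interval_space I) point_space
     (tangent_times I g) (algebroid_of_lie h) Phi phi ->
     forall s, lie_morphism (fun x => Phi s (0, x)).
  case=> _ _ brPhi s.
  have [c [psi [_ spsi PhiE]]] := bundle_morphism_normal_form hPhi.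
  have -> : (fun x => Phi s (0, x)) = psi s.
    by apply/funext => x; rewrite PhiE scale0r add0r.
  exact: (bracket_compatible_lie_morphism hPhi PhiE brPhi s).
have LA_nf : @LA_morphism R (interval_space I) point_space
     (tangent_times I g) (algebroid_of_lie h) Phi phi <-> normal_form.
  split=> [[_ _ brPhi]|[c [psi [sc spsi psi0 PhiE psi_ode]]]].
    have [c [psi [sc spsi PhiE]]] := bundle_morphism_normal_form hPhi.
    exists c, psi; split=> //.
    - exact: (bracket_compatible_lie_morphism hPhi PhiE brPhi i0).
    - exact: (bracket_compatible_ode hPhi spsi PhiE brPhi).
  split=> //; first exact: anchor_compatible_point.
  apply: (bracket_compatible_normal_form sc spsi psi_ode PhiE) => //.
  exact: (lie_morphism_propagates sc spsi psi_ode psi0).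
split=> //; split=> [[_ _ /LA_nf]//|/LA_nf LA].
by split=> //; exact: LA_lie.
Qed.
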